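(* Let $(X,\mathcal{F},\tau)$ be a probabilistic metric space with $\tau$ continuous, endowed with its strong topology, let $x=\{x_k\}_{k\in\mathbb{N}}$ be a sequence in $X$ and let $\lambda\in\Delta_\infty$. Then $\Lambda_x^{st}(\lambda)^{\mathcal{F}}_{s}\subset\Gamma_x^{st}(\lambda)^{\mathcal{F}}_{s}\subset L_x^{\mathcal{F}}$, i.e. every strong $\lambda$-statistical limit point of $x$ is a strong $\lambda$-statistical cluster point of $x$, and every strong $\lambda$-statistical cluster point of $x$ is a strong limit point of the sequence $x$.
   Context: Distance distribution functions: $\mathcal{D}^{+}$ is the set of nondecreasing functions $h:[0,\infty]\to[0,1]$ with $h(0)=0$, $h(\infty)=1$, left continuous on $(0,\infty)$; where negative arguments occur, $h$ is extended by $h(x)=0$ for $x<0$. $\mathcal{D}^+$ is ordered pointwise. $\epsilon_0\in\mathcal{D}^+$ is given by $\epsilon_0(x)=0$ for $x\le 0$ and $\epsilon_0(x)=1$ for $x>0$. The metric $d_L$ on $\mathcal{D}^+$: $d_L(f,g)$ is the infimum of all $w\in(0,1]$ such that $f(x-w)-w\le g(x)\le f(x+w)+w$ and $g(x-w)-w\le f(x)\le g(x+w)+w$ for every $x\in(-\frac1w,\frac1w)$. A triangle function is a binary operation $\tau$ on $\mathcal{D}^+$ that is commutative, associative, nondecreasing in each place, and has $\epsilon_0$ as identity. Continuity of $\tau$ is with respect to $d_L$. A probabilistic metric (PM) space is a triplet $(X,\mathcal{F},\tau)$ with $X$ a nonempty set, $\mathcal{F}:X\times X\to\mathcal{D}^+$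 (write $\mathcal{F}_{xy}=\mathcal{F}(x,y)$) and $\tau$ a triangle function such that for all $x,y,z\in X$: $\mathcal{F}_{xx}=\epsilon_0$; $\mathcal{F}_{xy}\ne\epsilon_0$ if $x\ne y$; $\mathcal{F}_{xy}=\mathcal{F}_{yx}$; $\mathcal{F}_{xz}\ge\tau(\mathcal{F}_{xy},\mathcal{F}_{yz})$. For $x\in X$, $r>0$ let $\mathcal{N}_x(r)=\{y\in X:\mathcal{F}_{xy}(r)>1-r\}$. When $\tau$ is continuous these form a neighborhood system of a Hausdorff topology on $X$, the strong topology. $\Delta_\infty$ is the set of non-decreasing sequences $\lambda=\{\lambda_n\}_{n\in\mathbb{N}}$ of positive reals tending to $\infty$ with $\lambda_1=1$ and $\lambda_{n+1}\le\lambda_n+1$ for all $n$. With $I_n=[n-\lambda_n+1,n]$, the $\lambda$-density of $M\subset\mathbb{N}$ is $d_\lambda(M)=\lim_{n\to\infty}\frac{|\{k\in I_n:k\in M\}|}{\lambda_n}$ when the limit exists. ''$M$ does not have $\lambda$-density zero'' means that either $d_\lambda(M)$ exists and is positive, or $M$ fails to have a $\lambda$-density. A sequence $\{y_k\}$ in $X$ converges strongly to $\mathcal{L}\in X$ if for every $t>0$ there is $k_0\in\mathbb{N}$ with $y_k\in\mathcal{N}_{\mathcal{L}}(t)$ for all $k\ge k_0$. A subsequence $\{x_{q_k}\}_{k\in\mathbb{N}}$ of $x$ is $\lambda$-nonthin if the set $\{q_k:k\in\mathbb{N}\}$ does not have $\lambda$-density zero. $L_x^{\mathcal{F}}$ (strong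 limit points of $x$) is the set of $l\in X$ such that some subsequence of $x$ converges strongly to $l$. $\Lambda_x^{st}(\lambda)^{\mathcal{F}}_{s}$ (strong $\lambda$-statistical limit points of $x$) is the set of $\mathcal{L}\in X$ such that some $\lambda$-nonthin subsequence of $x$ converges strongly to $\mathcal{L}$. $\Gamma_x^{st}(\lambda)^{\mathcal{F}}_{s}$ (strong $\lambda$-statistical cluster points of $x$) is the set of $\mathcal{Y}\in X$ such that for every $t>0$ the set $\{k\in\mathbb{N}:\mathcal{F}_{x_k\mathcal{Y}}(t)>1-t\}$ does not have $\lambda$-density zero. *)

(* Defs.v *)
From mathcomp Require Import all_boot all_order all_algebra.
From mathcomp Require Import finmap.
From mathcomp Require Import all_classical all_reals all_analysis.

Set Implicit Arguments.
Unset Strict Implicit.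
Unset Printing Implicit Defensive.
Import Order.TTheory GRing.Theory Num.Theory.
Import numFieldNormedType.Exports.
Local Open Scope classical_set_scope.
Local Open Scope ring_scope.

(* Distance distribution functions.  Elements of D^+ live on [0, +oo]; they are
   represented by their extension by 0 to the negative part of \bar R, so that
   Leibniz equality of [ddf] is equality of functions on [0, +oo]. *)
Record ddf (R : realType) := Ddf {
  ddf_fun :> \bar R -> R ;
  ddf_homo : {homo ddf_fun : s t / (s <= t)%E >-> s <= t} ;
  ddf_range : forall t, 0 <= ddf_fun t <= 1 ;
  ddf_neg : forall t, (t < 0)%E -> ddf_fun t = 0 ;
  ddf_at0 : ddf_fun 0%E = 0 ;
  ddf_aty : ddf_fun +oo%E = 1 ;
  ddf_left_cts : forall t : R, 0 < t ->
    ddf_fun s%:E @[s --> t^'-] --> ddf_fun t%:E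
}.

Definition ddf_le (R : realType) (f g : ddf R) : Prop :=
  forall t : \bar R, f t <= g t.

Definition eps0_fun (R : realType) (t : \bar R) : R :=
  if (t <= 0)%E then 0 else 1.

Section Eps0.
Variable R : realType.

Lemma eps0_homo : {homo @eps0_fun R : s t / (s <= t)%E >-> s <= t}.
Proof.
move=> s t st; rewrite /eps0_fun; case: ifPn => s0; case: ifPn => t0 //.
by rewrite (le_trans st t0) in s0.
Qed.

Lemma eps0_range (t : \bar R) : 0 <= eps0_fun t <= 1.
Proof. by rewrite /eps0_fun; case: ifPn => _; rewrite ?lexx ?ler01. Qed.

Lemma eps0_neg (t : \bar R) : (t < 0)%E -> eps0_fun t = 0.
Proof. by move=> t0; rewrite /eps0_fun (ltW t0). Qed.

Lemma eps0_at0 : eps0_fun (0%E : \bar R) = 0.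
Proof. by rewrite /eps0_fun lexx. Qed.

Lemma eps0_aty : eps0_fun (+oo%E : \bar R) = 1.
Proof. by []. Qed.

Lemma eps0_left_cts (t : R) : 0 < t ->
  eps0_fun s%:E @[s --> t^'-] --> eps0_fun t%:E.
Proof.
move=> t0; rewrite {2}/eps0_fun lee_fin leNgt t0 /=.
apply: cvg_near_cst; near=> s.
rewrite /eps0_fun lee_fin leNgt ifN // negbK.
by near: s; exact: nbhs_left_gt.
Unshelve. all: by end_near. Qed.

Definition eps0 : ddf R :=
  Ddf eps0_homo eps0_range eps0_neg eps0_at0 eps0_aty eps0_left_cts.

End Eps0.
Arguments eps0 {R}.

Definition dL (R : realType) (f g : ddf R) : R :=
  inf [set w : R | 0 < w <= 1 /\
    forall t : R, - (1 / w) < t < 1 / w ->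
      (f (t - w)%:E - w <= g t%:E <= f (t + w)%:E + w) /\
      (g (t - w)%:E - w <= f t%:E <= g (t + w)%:E + w)].

Record triangle_function (R : realType) (tau : ddf R -> ddf R -> ddf R)
    : Prop := {
  tf_comm : forall f g, tau f g = tau g f ;
  tf_assoc : forall f g h, tau f (tau g h) = tau (tau f g) h ;
  tf_monol : forall f f' g, ddf_le f f' -> ddf_le (tau f g) (tau f' g) ;
  tf_monor : forall f g g', ddf_le g g' -> ddf_le (tau f g) (tau f g') ;
  tf_idl : forall f, tau eps0 f = f ;
  tf_idr : forall f, tau f eps0 = f
}.

(* Joint continuity on D^+ x D^+, both factors carrying the metric [dL]. *)
Definition dL_continuous (R : realType) (tau : ddf R -> ddf R -> ddf R) : Prop :=
  forall (f g : ddf R) (e : R), 0 < e ->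
    exists2 d : R, 0 < d &
      forall f' g' : ddf R, dL f f' < d -> dL g g' < d ->
        dL (tau f g) (tau f' g') < e.

Record pm_space (R : realType) (X : Type) (F : X -> X -> ddf R)
    (tau : ddf R -> ddf R -> ddf R) : Prop := {
  pm_inhabited : inhabited X ;
  pm_triangle_function : triangle_function tau ;
  pm_refl : forall x, F x x = eps0 ;
  pm_sep : forall x y, x <> y -> F x y <> eps0 ;
  pm_sym : forall x y, F x y = F y x ;
  pm_triangle : forall x y z, ddf_le (tau (F x y) (F y z)) (F x z)
}.

Definition strong_nbhd (R : realType) (X : Type) (F : X -> X -> ddf R)
    (x : X) (r : R) : set X :=
  [set y | F x y r%:E > 1 - r].

(* Sequences are indexed by the positive integers: a sequence is a function on
   [nat] whose value at 0 is never used. *)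

Record Delta_infty (R : realType) (lam : nat -> R) : Prop := {
  Delta_gt0 : forall n, (0 < n)%N -> 0 < lam n ;
  Delta_nondecreasing : forall n, (0 < n)%N -> lam n <= lam n.+1 ;
  Delta_cvgy : lam n @[n --> \oo] --> +oo ;
  Delta_1 : lam 1%N = 1 ;
  Delta_step : forall n, (0 < n)%N -> lam n.+1 <= lam n + 1
}.

(* For lam in Delta_infty one has lam n <= n when 0 < n, so that 0 is not in
   the window I_n. *)
Definition lam_window (R : realType) (lam : nat -> R) (n : nat) : set nat :=
  [set k | n%:R - lam n + 1 <= k%:R <= (n%:R : R)].

Definition has_lam_density (R : realType) (lam : nat -> R) (M : set nat)
    (d : R) : Prop :=
  (#|` fset_set [set k | lam_window lam n k /\ M k]|%:R / lam n : R)
    @[n --> \oo] --> d.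

Definition not_lam_density_zero (R : realType) (lam : nat -> R) (M : set nat)
    : Prop :=
  (exists2 d : R, has_lam_density lam M d & 0 < d) \/
  ~ (exists d : R, has_lam_density lam M d).

Definition strongly_converges (R : realType) (X : Type) (F : X -> X -> ddf R)
    (y : nat -> X) (l : X) : Prop :=
  forall t : R, 0 < t -> \forall k \near \oo, strong_nbhd F l t (y k).

Definition subseq_index (q : nat -> nat) : Prop :=
  forall k, (0 < k)%N -> (0 < q k)%N /\ (q k < q k.+1)%N.

Definition lam_nonthin (R : realType) (lam : nat -> R) (q : nat -> nat) : Prop :=
  not_lam_density_zero lam [set q k | k in [set k | (0 < k)%N]].

Definition strong_limit_points (R : realType) (X : Type)
    (F : X -> X -> ddf R) (x : nat -> X) : set X :=
  [set l | exists2 q : nat -> nat, subseq_index q &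
    strongly_converges F (fun k => x (q k)) l].

Definition strong_stat_limit_points (R : realType) (X : Type)
    (F : X -> X -> ddf R) (lam : nat -> R) (x : nat -> X) : set X :=
  [set l | exists q : nat -> nat, [/\ subseq_index q, lam_nonthin lam q &
    strongly_converges F (fun k => x (q k)) l]].

Definition strong_stat_cluster_points (R : realType) (X : Type)
    (F : X -> X -> ddf R) (lam : nat -> R) (x : nat -> X) : set X :=
  [set y | forall t : R, 0 < t ->
    not_lam_density_zero lam [set k | (0 < k)%N /\ F (x k) y t%:E > 1 - t]].

(* Main.v *)
(* Only finitely many indices of a subsequence converging strongly to l miss a
   given neighbourhood of l, and the density zero property is inherited by
   almost-subsets because lam tends to infinity; this gives the first inclusion.
   For the second, a set not of density zero is infinite, so one can choose
   recursively an increasing sequence of indices q k with x (q k) in the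
   neighbourhood of radius 1/k. *)
Require Import Defs.
From mathcomp Require Import all_boot all_order all_algebra.
From mathcomp Require Import finmap.
From mathcomp Require Import all_classical all_reals all_analysis.

Import Order.TTheory GRing.Theory Num.Theory.
Import numFieldNormedType.Exports.

Local Open Scope classical_set_scope.
Local Open Scope ring_scope.

(** The value [lam 0] is unconstrained, so positivity is only claimed eventually. *)
Lemma Delta_infty_gt0_near {R : realType} {lam : nat -> R} :
  Delta_infty lam -> \forall n \near \oo, 0 < lam n.
Proof.
move=> hlam; near=> n; apply: (Delta_gt0 hlam).
by near: n; exact: nbhs_infty_gt.
Unshelve. all: by end_near. Qed.

Lemma has_lam_density_ge0 {R : realType} {lam : nat -> R} {M : set nat} {d : R} :
  Delta_infty lam -> has_lam_density lam M d -> 0 <= d.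
Proof.
move=> hlam hM; rewrite -(cvg_lim _ hM)//.
apply: limr_ge; first by apply/cvg_ex; exists d.
near=> n; rewrite divr_ge0// ltW//.
by near: n; exact: Delta_infty_gt0_near.
Unshelve. all: by end_near. Qed.

(** A density that exists is a limit of eventually nonnegative quotients, so nonzero means positive
    and the two cases merge into one negation. *)
Lemma not_lam_density_zeroP {R : realType} {lam : nat -> R} (M : set nat) :
  Delta_infty lam ->
  not_lam_density_zero lam M <-> ~ has_lam_density lam M 0.
Proof.
move=> hlam; split.
  move=> [[d hd d0] h0|h h0]; last by apply: h; exists 0.
  by move: d0; rewrite (cvg_unique _ hd h0)// ltxx.
move=> h; have [[d hd]|] := pselect (exists d, has_lam_density lam M d);
  [left; exists d => //|by right].
rewrite lt_neqAle (has_lam_density_ge0 hlam hd) andbT.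
by apply/eqP => d0; apply: h; rewrite d0.
Qed.

(** Needed because [fset_set] counts correctly only on finite sets. *)
Lemma finite_lam_window {R : realType} (lam : nat -> R) (n : nat) :
  finite_set (lam_window lam n).
Proof.
apply: (@sub_finite_set _ _ `I_n.+1); last exact: finite_II.
by move=> k /= /andP[_]; rewrite ler_nat.
Qed.

Lemma has_lam_density0 {R : realType} (lam : nat -> R) :
  has_lam_density lam set0 0.
Proof.
apply: cvg_near_cst; apply: nearW => n.
have -> : [set k | lam_window lam n k /\ set0 k] = set0.
  by apply/seteqP; split=> k // -[].
by rewrite fset_set0 cardfs0 mul0r.
Qed.

(** In every window the count for [M] exceeds that for [A] by at most the number of indices below a
    fixed threshold, and this constant over [lam n] tends to 0. *)
Lemma has_lam_density0_almost_subset {R : realType} {lam : nat -> R}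
    {M A : set nat} :
  Delta_infty lam -> (\forall k \near \oo, M k -> A k) ->
  has_lam_density lam A 0 -> has_lam_density lam M 0.
Proof.
move=> hlam [N _ hN] hA.
set c := fun (B : set nat) n => #|` fset_set [set k | lam_window lam n k /\ B k]|.
have finB B n : finite_set [set k | lam_window lam n k /\ B k].
  by apply: sub_finite_set (finite_lam_window lam n) => k [].
have leM n : (c M n <= c A n + #|` fset_set `I_N|)%N.
  have := leq_card_fsetU (fset_set [set k | lam_window lam n k /\ A k])
    (fset_set `I_N).
  move=> [+ _]; apply: leq_trans.
  rewrite -fset_setU//; apply: fsubset_leq_card.
  rewrite -fset_set_sub//; last by rewrite finite_setU.
  move=> k /= [wk Mk]; have [kN|Nk] := ltnP k N; [by right|left].
  by split=> //; apply: hN.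
have hC : (#|` fset_set `I_N|%:R / lam n) @[n --> \oo] --> (0 : R).
  rewrite -[X in _ --> X](mulr0 #|` fset_set `I_N|%:R).
  apply: cvgM; first exact: cvg_cst.
  apply/gtr0_cvgV0; last exact: (Delta_cvgy hlam).
  exact: Delta_infty_gt0_near.
have hAC : ((c A n)%:R / lam n + #|` fset_set `I_N|%:R / lam n) @[n --> \oo]
    --> (0 : R).
  by rewrite -[X in _ --> X](addr0 (0 : R)); exact: cvgD hA hC.
apply: (squeeze_cvgr _ (@cvg_cst _ _ _ _ _) hAC).
near=> n; have lam0 : 0 < lam n by near: n; exact: Delta_infty_gt0_near.
rewrite divr_ge0 ?(ltW lam0)//=.
rewrite -(mulrDl (c A n)%:R) ler_pM2r ?invr_gt0// -natrD ler_nat.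
exact: leM.
Unshelve. all: by end_near. Qed.

Lemma subseq_index_leq {q : nat -> nat} {j k : nat} :
  subseq_index q -> (0 < j)%N -> (j <= k)%N -> (q j <= q k)%N.
Proof.
move=> hq j0; elim: k => [|k IH]; first by rewrite leqn0 => /eqP ->.
rewrite leq_eqVlt => /orP[/eqP -> //|jk].
have [_ /ltnW] := hq k (leq_trans j0 jk).
exact: leq_trans (IH jk).
Qed.

Theorem theorem4p1 (R : realType) (X : Type) (F : X -> X -> ddf R)
    (tau : ddf R -> ddf R -> ddf R) (hpm : pm_space F tau)
    (htau : dL_continuous tau) (x : nat -> X) (lam : nat -> R)
    (hlam : Delta_infty lam) :
  strong_stat_limit_points F lam x `<=` strong_stat_cluster_points F lam x /\
  strong_stat_cluster_points F lam x `<=` strong_limit_points F x.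
Proof.
split=> [l [q [hq /(not_lam_density_zeroP _ hlam) qthin qcvg]] t t0|y ycl].
  apply/(not_lam_density_zeroP _ hlam) => A0; apply: qthin.
  apply: has_lam_density0_almost_subset hlam _ A0.
  have [N _ hN] := qcvg t t0.
  (* An index [q k] beyond [q N] forces [N <= k], since [q] is monotone. *)
  exists (q N).+1 => // m /= /[swap] -[k /= k0 <-] qk; split; first by have [] := hq k k0.
  rewrite (pm_sym hpm); apply: hN => /=.
  rewrite leqNgt; apply/negP => kN.
  have := leq_ltn_trans (subseq_index_leq hq k0 (ltnW kN)) qk.
  by rewrite ltnn.
have pick (nk : nat * nat) : exists m : nat, (nk.1 < m)%N /\
    strong_nbhd F y nk.2.+1%:R^-1 (x m).
  have /(not_lam_density_zeroP _ hlam) h := ycl nk.2.+1%:R^-1 ltac:(by rewrite invr_gt0).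
  (* Without such an [m], the index set would be almost contained in [set0], hence of density
     zero. *)
  apply: contrapT => nex; apply: h.
  apply: has_lam_density0_almost_subset hlam _ (has_lam_density0 lam).
  exists nk.1.+1 => // m /= nm [_ Fm]; apply: nex; exists m; split=> //.
  by rewrite /strong_nbhd /= (pm_sym hpm).
have [next hnext] := choice pick.
(* The pair carries the previous index and the step number; starting from 0 makes [q 1] positive. *)
pose q := fix q k := if k is k'.+1 then next (q k', k') else 0%N.
have q_lt k : (q k < q k.+1)%N by have [] := hnext (q k, k).
have hq k : strong_nbhd F y k.+1%:R^-1 (x (q k.+1)) by have [] := hnext (q k, k).
exists q => [[//|k] _|t t0]; first by split=> //; exact: leq_ltn_trans (q_lt k).
have [N _ hN] := near_infty_natSinv_lt (PosNum t0).
exists N.+1 => // -[//|k] /= /hN /= /ltW kt.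
rewrite /strong_nbhd /=.
(* Neighbourhoods grow with the radius: with s the inverse of [k.+1] and s <= t, 1 - t <= 1 - s <
   F(s) <= F(t). *)
apply: le_lt_trans (_ : 1 - k.+1%:R^-1 < _); first by rewrite lerD2l lerN2.
apply: lt_le_trans (hq k) _; apply: ddf_homo.
by rewrite lee_fin.
Qed.
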